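(* Let $Q$ be an Osborn loop. Each of the following conditions is necessary and sufficient for $Q$ to be a Moufang loop: (i) $Q$ has the left inverse property (LIP); (ii) $Q$ has the right inverse property (RIP); (iii) $Q$ is flexible (FLX); (iv) $Q$ has the left alternative property (LAP); (v) $Q$ has the right alternative property (RAP).
   Context: A loop $Q$ is an Osborn loop if for each $x\in Q$ there exists a permutation $\alpha_x$ of $Q$ such that $\alpha_x(y)\cdot(zx)=x((yz)x)$ for all $y,z\in Q$. A loop is Moufang if $(xy)(zx)=x((yz)x)$ for all $x,y,z$. Put $x^\lambda=1/x$ and $x^\rho=x\backslash 1$, so that $x^\lambda x=1=xx^\rho$. The properties, required for all $x,y\in Q$, are: LIP: $x^\lambda(xy)=y$; RIP: $(yx)x^\rho=y$; FLX: $(xy)x=x(yx)$; LAP: $x(xy)=(xx)y$; RAP: $(yx)x=y(xx)$. *)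

(* Defs.v *)
From HB Require Import structures.
From mathcomp Require Import all_boot.

Set Implicit Arguments.
Unset Strict Implicit.
Unset Printing Implicit Defensive.

Local Open Scope group_scope.

(* The base umagma is only a set with a product and a constant 1, so that,
   contrary to umagmaType, no choice structure is required on the carrier.
   [ldiv x y] is x \ y and [rdiv y x] is y / x. *)
HB.mixin Record BaseUMagma_isLoop G of BaseUMagma G := {
  ldiv : G -> G -> G;
  rdiv : G -> G -> G;
  loop_mul1g : left_id (1 : G) *%g;
  loop_mulg1 : right_id (1 : G) *%g;
  mul_ldiv : forall x y : G, x * ldiv x y = y;
  ldiv_mul : forall x y : G, ldiv x (x * y) = y;
  rdiv_mul : forall x y : G, rdiv y x * x = y;
  mul_rdiv : forall x y : G, rdiv (y * x) x = y
}.

#[short(type="loopType")]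
HB.structure Definition Loop := {G of BaseUMagma_isLoop G & BaseUMagma G}.

Section LoopProperties.

Variable Q : loopType.

Definition linv (x : Q) : Q := rdiv 1 x.
Definition rinv (x : Q) : Q := ldiv x 1.

Definition osborn : Prop :=
  forall x : Q, exists2 alpha : Q -> Q, bijective alpha &
    forall y z : Q, alpha y * (z * x) = x * ((y * z) * x).

Definition moufang : Prop :=
  forall x y z : Q, (x * y) * (z * x) = x * ((y * z) * x).

Definition LIP : Prop := forall x y : Q, linv x * (x * y) = y.

Definition RIP : Prop := forall x y : Q, (y * x) * rinv x = y.

Definition FLX : Prop := forall x y : Q, (x * y) * x = x * (y * x).

Definition LAP : Prop := forall x y : Q, x * (x * y) = (x * x) * y.

Definition RAP : Prop := forall x y : Q, (y * x) * x = y * (x * x).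

End LoopProperties.

(* Main.v *)
Require Import Defs.
From HB Require Import structures.
From mathcomp Require Import all_boot.

(** Write [u] for the left inverse of [x], and L, R for the left and right
translations.  The Osborn law says that (alpha_x, R_x, L_x R_x) is an
autotopism of the loop, that is, a triple (A, B, C) of permutations with
A y * B z = C (y * z); call it the triple of [x].  Autotopisms compose, and
evaluating at 1 shows that one whose first component fixes 1 has B = C, and
that one whose second component fixes 1 has A = C.

Putting z = 1 in the Osborn law gives alpha_x = R_x^-1 L_x R_x, so alpha_x maps
[u] to 1; putting y = u then gives alpha_x = L_u^-1 ([osborn_linvE]).  A loop
is Moufang when alpha_x = L_x, which by the first formula is flexibility, and
by the second one the left inverse property.

The remaining conditions reduce to these two.  Under RIP, R_x and R_u are
mutually inverse, so the composite of the triples of [x] and [u] has trivial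
second component, which makes it trivial and forces L_u L_x = 1
([osborn_RIP_LIP]).  Under RAP, the Osborn law with z = x is flexibility
([osborn_RAP_FLX]).  Under LAP, the left inverse of x^2 is u^2, so the square
of the triple of [x] and the triple of x^2 have the same first component; then
so are their second components, which is RAP ([osborn_LAP_RAP]).

Conversely a Moufang loop is flexible and has LIP; composing the triples of
[x] and [u] then yields RIP ([moufang_LIP_RIP]), and the two alternative laws
are specializations of the Moufang identity. *)

Local Open Scope group_scope.

Section Loops.

Variable Q : loopType.
Implicit Types x y z : Q.

Lemma loop_mulI x : injective (fun y => x * y).
Proof. by move=> y z /(congr1 (ldiv x)); rewrite !ldiv_mul. Qed.

Lemma loop_Imul x : injective (fun y => y * x).
Proof. by move=> y z /(congr1 (fun t => rdiv t x)); rewrite !mul_rdiv. Qed.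

Lemma linv_mul x : linv x * x = 1.
Proof. exact: rdiv_mul. Qed.

Lemma linv_unique x y : y * x = 1 -> linv x = y.
Proof. by move=> yx; apply: (loop_Imul x); rewrite /= linv_mul. Qed.

Lemma rinv_unique x y : x * y = 1 -> rinv x = y.
Proof. by move=> xy; apply: (loop_mulI x); rewrite /= mul_ldiv. Qed.

Lemma rinv_linv x : rinv (linv x) = x.
Proof. exact: rinv_unique (linv_mul x). Qed.

Lemma LIP_mul_linv x : LIP Q -> x * linv x = 1.
Proof.
by move=> lip; apply: (loop_mulI (linv x)); rewrite /= lip loop_mulg1.
Qed.

Lemma moufang_FLX : moufang Q -> FLX Q.
Proof.
by move=> mou x y; have := mou x y 1; rewrite !loop_mul1g loop_mulg1.
Qed.

(** The composite of the triples of [x] and [u] is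
(L_u L_x, R_u R_x, L_u R_u L_x R_x).  By LIP and flexibility its first
component is trivial and its third one is R_u R_x, so that
y (R_u R_x z) = R_u R_x (y z); taking for y the left inverse of z shows that
R_u R_x is trivial too. *)
Lemma moufang_LIP_RIP : moufang Q -> LIP Q -> RIP Q.
Proof.
move=> mou lip x z; rewrite (rinv_unique _ _ (LIP_mul_linv x lip)).
set u := linv x.
have comp y : y * ((z * x) * u) = ((y * z) * x) * u.
  by rewrite -{1}(lip x y) mou mou -(moufang_FLX mou) lip.
apply: (loop_mulI (linv z)).
by rewrite /= comp linv_mul loop_mul1g LIP_mul_linv.
Qed.

Lemma moufang_LAP : moufang Q -> LIP Q -> LAP Q.
Proof.
move=> mou lip x t; have rip := moufang_LIP_RIP mou lip.
have tE : (t * linv x) * x = t.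
  by have := rip (linv x) t; rewrite rinv_linv.
(* In the Moufang identity for (x x) (z x) take z = t u. *)
by rewrite -{2}tE mou (moufang_FLX mou) tE.
Qed.

Lemma moufang_RAP : moufang Q -> LIP Q -> RAP Q.
Proof.
move=> mou lip x t; have flx := moufang_FLX mou.
(* With t = x y, both sides are x ((y x) x) by flexibility. *)
by rewrite -(mul_ldiv x t) mou flx flx.
Qed.

Section Osborn.

Hypothesis osbQ : osborn Q.

(** This is the identification of alpha_x with L_u^-1.  Since alpha_x maps [u]
to 1, y = u in the Osborn law gives z x = x ((u z) x), that is,
R_x = L_x R_x L_u, and so alpha_x = R_x^-1 L_x R_x is inverse to L_u. *)
Lemma osborn_linvE x y z :
  ldiv (linv x) y * (z * x) = x * ((y * z) * x).
Proof.
have [a _ aE] := osbQ x; set u := linv x.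
have aE1 s : a s * x = x * (s * x).
  by have := aE s 1; rewrite loop_mul1g loop_mulg1.
have au : a u = 1.
  by apply: (loop_Imul x); rewrite /= aE1 linv_mul loop_mulg1 loop_mul1g.
have aL t : a (u * t) = t.
  by apply: (loop_Imul x); rewrite /= aE1 -aE au loop_mul1g.
by rewrite -aE -{2}(mul_ldiv u y) aL.
Qed.

Lemma osborn_LIP_moufang : LIP Q -> moufang Q.
Proof.
move=> lip x y z.
by rewrite -osborn_linvE -{2}(lip x y) ldiv_mul.
Qed.

Lemma osborn_FLX_moufang : FLX Q -> moufang Q.
Proof.
move=> flx x y z; rewrite -osborn_linvE; congr (_ * _).
apply: (loop_Imul x); rewrite /= flx.
by have := osborn_linvE x y 1; rewrite loop_mul1g loop_mulg1.
Qed.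

Lemma moufang_LIP : moufang Q -> LIP Q.
Proof.
move=> mou x y; have := osborn_linvE x y 1.
by rewrite -mou => /loop_Imul <-; rewrite mul_ldiv.
Qed.

(** RIP makes [u] a two-sided inverse of [x], so that the triples of [u] and
[x] compose to (L_x^-1 L_u^-1, R_u R_x, _), whose second component is trivial.
As the first component fixes 1, the third one is trivial, and hence so is the
first. *)
Lemma osborn_RIP_LIP : RIP Q -> LIP Q.
Proof.
move=> rip x y; set u := linv x.
have rx : rinv x = u by rewrite -[rinv x]loop_mul1g -(linv_mul x) rip.
have xu : linv u = x by apply: linv_unique; rewrite -rx mul_ldiv.
have uK t : (t * x) * u = t by rewrite -rx rip.
have comp s z : ldiv x (ldiv u s) * z = u * ((x * ((s * z) * x)) * u).
  by have := osborn_linvE u (ldiv u s) (z * x); rewrite xu uK osborn_linvE.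
have C1 z : u * ((x * (z * x)) * u) = z.
  have := comp 1 z; rewrite -[ldiv u 1]/(rinv (linv x)) rinv_linv.
  have -> : ldiv x x = 1 by rewrite -{2}(loop_mulg1 x) ldiv_mul.
  by rewrite !loop_mul1g.
have inv s : ldiv x (ldiv u s) = s.
  by apply: (loop_Imul 1); rewrite /= comp C1.
by rewrite -{1}(inv y) !mul_ldiv.
Qed.

(** With z = x and RAP the Osborn law becomes
((alpha_x y) x) x = x ((y x) x), where (alpha_x y) x = x (y x), and every
element has the form y x. *)
Lemma osborn_RAP_FLX : RAP Q -> FLX Q.
Proof.
move=> rap x t; rewrite -(rdiv_mul x t) -osborn_linvE -rap.
by have := osborn_linvE x (rdiv t x) 1; rewrite loop_mul1g loop_mulg1 => ->.
Qed.

(** The identity t x = x ((u t) x) at t = x^2 gives u x^2 = x, so that u^2 is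
the left inverse of x^2 and alpha_(x^2) = L_u^-2 = alpha_x^2. *)
Lemma osborn_LAP_RAP : LAP Q -> RAP Q.
Proof.
move=> lap x z; set u := linv x.
have conj t : x * ((u * t) * x) = t * x.
  by have := osborn_linvE x (u * t) 1; rewrite ldiv_mul loop_mul1g loop_mulg1.
have uxx : u * (x * x) = x.
  by have := conj (x * x); rewrite -lap => /loop_mulI /loop_Imul.
have wE : linv (x * x) = u * u.
  by apply: linv_unique; rewrite -lap uxx linv_mul.
have ldivE y : ldiv (u * u) y = ldiv u (ldiv u y).
  by apply: (loop_mulI (u * u)); rewrite /= mul_ldiv -lap !mul_ldiv.
have sq y s : ldiv u (ldiv u y) * ((s * x) * x)
    = x * ((x * ((y * s) * x)) * x).
  by rewrite osborn_linvE osborn_linvE.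
have sq2 y s : ldiv u (ldiv u y) * (s * (x * x))
    = (x * x) * ((y * s) * (x * x)).
  by rewrite -ldivE -wE osborn_linvE.
(* The second components agree at 1, and therefore so do the third ones. *)
have third t : x * ((x * (t * x)) * x) = (x * x) * (t * (x * x)).
  by rewrite -(loop_mulg1 t) -sq -sq2 !loop_mul1g.
by apply: (loop_mulI (ldiv u (ldiv u 1))); rewrite /= sq third -sq2.
Qed.

End Osborn.

End Loops.

Theorem theorem3p4 (Q : loopType) (hQ : osborn Q) :
  (LIP Q <-> moufang Q) /\
  (RIP Q <-> moufang Q) /\
  (FLX Q <-> moufang Q) /\
  (LAP Q <-> moufang Q) /\
  (RAP Q <-> moufang Q).
Proof.
have lip := @moufang_LIP Q hQ.
have rap_mou rap := osborn_FLX_moufang _ hQ (osborn_RAP_FLX _ hQ rap).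
do ![split].
- exact: osborn_LIP_moufang.
- exact: lip.
- by move=> rip; apply: osborn_LIP_moufang => //; apply: osborn_RIP_LIP.
- by move=> mou; apply: moufang_LIP_RIP; last exact: lip.
- exact: osborn_FLX_moufang.
- exact: moufang_FLX.
- by move=> lap; apply: rap_mou; apply: osborn_LAP_RAP.
- by move=> mou; apply: moufang_LAP; last exact: lip.
- exact: rap_mou.
- by move=> mou; apply: moufang_RAP; last exact: lip.
Qed.
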